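(* Let $K$ be an origin-symmetric star body in $\mathbb S^2_+$. Then $$\int_{S^1} \mathrm{vol}(K\cap\xi^\perp)^2\, d\xi\ge 8\pi\arccos^2\big(1-\mathrm{vol}(K)/(2\pi)\big),$$ with equality if and only if $K$ is a ball centered at the origin.
   Context: $\mathbb S^2_+$ is the closed upper hemisphere of the unit sphere in $\mathbb R^3$, with its geodesic distance $\mathrm d$; the origin $o$ is the center (pole) of the hemisphere. $S^1$ is the unit circle in the tangent plane $T_o\mathbb S^2_+$, with arc-length measure $d\xi$ of total mass $2\pi$. For $\xi\in S^1$, $\xi^\perp$ is the geodesic line of $\mathbb S^2_+$ through $o$ with normal $\xi$ at $o$. $\mathrm{vol}$ is spherical area (for subsets of $\mathbb S^2_+$) or length (for subsets of $\xi^\perp$). A set $K$ is star-shaped if every geodesic through $o$ meets $K$ in a connected segment containing $o$; its radial function $\rho_K(\xi)\in[0,\pi/2]$ is the supremum of $\mathrm d(x,o)$ over $x\in K$ on the geodesic ray from $o$ in direction $\xi$. $K$ is a star body if it is compact, star-shaped and $\rho_K$ is positive and continuous; it is origin-symmetric if $\rho_K(\xi)=\rho_K(-\xi)$ for all $\xi$. Thus $\mathrm{vol}(K)=\int_{S^1}(1-\cos\rho_K(u))\,du$ and $\mathrm{vol}(K\cap\xi^\perp)$ is the sum of $\rho_K$ over the two unit vectors orthogonal to $\xi$. *)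

(* Defs.v *)
From HB Require Import structures.
From mathcomp Require Import all_boot all_order all_algebra.
From mathcomp Require Import all_classical all_reals all_analysis.

Set Implicit Arguments.
Unset Strict Implicit.
Unset Printing Implicit Defensive.

Import Order.TTheory GRing.Theory Num.Theory.
Import numFieldNormedType.Exports.

Local Open Scope classical_set_scope.
Local Open Scope ring_scope.

Section Hemisphere.
Variable R : realType.

Local Notation space := 'rV[R]_3.
Local Notation mu := (@lebesgue_measure R).

Definition dot (x y : space) : R := \sum_(i < 3) x ord0 i * y ord0 i.

Definition pole : space := \row_(i < 3) [:: 0; 0; 1]`_i.

Definition hemisphere : set space :=
  [set x | dot x x = 1 /\ 0 <= dot x pole].

Definition geodist (x y : space) : R := acos (dot x y).

(* The tangent plane at the pole is identified with the orthogonal complement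
   of [pole] in R^3. *)
Definition tangent_circle : set space :=
  [set xi | dot xi xi = 1 /\ dot xi pole = 0].

Definition circle_pt (theta : R) : space :=
  \row_(i < 3) [:: cos theta; sin theta; 0]`_i.

Definition circle_integral (f : space -> R) : R :=
  (\int[mu]_(theta in `[0, 2 * pi]) f (circle_pt theta))%R.

(* Unit-speed geodesic from the pole, i.e. the exponential map at t *: u. *)
Definition geodesic (u : space) (t : R) : space :=
  cos t *: pole + sin t *: u.

Definition ray (u : space) : set space := geodesic u @` `[0, pi / 2].

(* The sets [perp xi], for xi in [tangent_circle], are exactly the geodesic
   lines of the hemisphere through the pole. *)
Definition perp (xi : space) : set space :=
  [set x | hemisphere x /\ dot x xi = 0].

Definition quarter_turn (xi : space) : space :=
  \row_(i < 3) [:: - xi ord0 1; xi ord0 0; 0]`_i.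

(* Spherical area in geodesic polar coordinates around the pole, where the area
   element is sin t dt dtheta. *)
Definition area (A : set space) : R :=
  circle_integral (fun u =>
    (\int[mu]_(t in `[0%R, (pi / 2)%R]) (\1_A (geodesic u t) * sin t))%R).

(* Length of a subset A of [perp xi], which is parametrized by arc length on
   [-pi/2, pi/2] by the geodesic in a direction orthogonal to xi. *)
Definition length_perp (xi : space) (A : set space) : R :=
  fine (mu (`[- (pi / 2), pi / 2] `&` geodesic (quarter_turn xi) @^-1` A)).

Definition star_shaped (K : set space) : Prop :=
  forall xi, tangent_circle xi ->
    (K `&` perp xi) pole /\ connected (K `&` perp xi).

Definition radial (K : set space) (u : space) : R :=
  sup [set geodist x pole | x in K `&` ray u].

Definition star_body (K : set space) : Prop :=
  [/\ K `<=` hemisphere, compact K, star_shaped K,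
      (forall u, tangent_circle u -> 0 < radial K u) &
      {within tangent_circle, continuous (radial K)}].

Definition origin_symmetric (K : set space) : Prop :=
  forall u, tangent_circle u -> radial K u = radial K (- u).

Definition centered_ball (r : R) : set space :=
  [set x | hemisphere x /\ geodist x pole <= r].

End Hemisphere.

Arguments pole {R}.
Arguments hemisphere {R}.
Arguments tangent_circle {R}.

(* Main.v *)
Require Import Defs.
From mathcomp Require Import all_boot all_order all_algebra.
From mathcomp Require Import all_classical all_reals all_analysis.
From mathcomp Require Import ring lra.
Import Order.TTheory GRing.Theory Num.Theory.
Import numFieldNormedType.Exports.
Local Open Scope classical_set_scope.
Local Open Scope ring_scope.

(** Write [rho th] for the radial function of [K] in the direction of angle [th].
By compactness and star-shapedness, [K] is exactly the set of the points
[geodesic u t] with [0 <= t <= radial K u] (lemma [geodesic_star_body]).  Polar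
coordinates then give the area of [K] as the integral of [1 - cos rho] over
[[0, 2 pi]], and the section of [K] by the line with normal [xi] has length
[2 rho (th + pi / 2)] when [xi] has angle [th], [K] being symmetric.  A shift of
the [2 pi]-periodic integrand turns the left-hand side into [4] times the
integral of [rho ^+ 2].

What remains is Jensen's inequality for the function [acos (1 - s) ^+ 2], which is
strictly convex on [[0, 1]]: the mean of [rho ^+ 2] is at least
[acos (1 - mean of (1 - cos rho)) ^+ 2].  It is proved in tangent form.  With [c]
the value of the arc cosine, the inequality
[r ^+ 2 >= c ^+ 2 + 2 c / sin c * (cos c - cos r)] of [sqr_gt_tangent] is strict
unless [r = c]; it is integrated with [r = rho th], where by the choice of [c] the
term in [cos c - cos r] has integral zero.  In the equality case a nonnegative
continuous function has integral zero, so [rho] is identically [c]; and a constant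
radial function means that [K] is a centered ball ([centered_ballP]). *)

(** * The tangent line inequality *)

(** By concavity of [sin], the slope [cos y] of its chord over [[0, a]] exceeds the
slope [cos x] of its chord over [[a, b]]; hence [sin x / x] decreases. *)
Lemma sin_ratio_decreasing {R : realType} (a b : R) :
  0 < a -> a < b -> b <= pi -> a * sin b < b * sin a.
Proof.
move=> a0 ab bpi.
have cs u v : {within `[u, v], continuous (@sin R)}.
  by apply: continuous_subspaceT; exact: continuous_sin.
have [x xab] := MVT ab (fun x _ => is_derive_sin x) (cs a b).
have [y y0a] := MVT a0 (fun x _ => is_derive_sin x) (cs 0 a).
rewrite sin0 !subr0 => sa sba.
move: xab y0a; rewrite !in_itv/= => /andP[ax xb] /andP[y0 ya].
have cxy : cos x < cos y.
  by rewrite ltr_cos ?in_itv/=; lra.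
have : 0 < a * (b - a) * (cos y - cos x) by rewrite !mulr_gt0//; lra.
suff -> : a * (b - a) * (cos y - cos x) = b * sin a - a * sin b by lra.
have -> : sin b = sin a + cos x * (b - a) by lra.
rewrite sa; ring.
Qed.

(** The function [acos (1 - s) ^+ 2] lies above its tangent at [s = 1 - cos c],
whose slope is [2 c / sin c]; here [s = 1 - cos r].  Up to the positive factor
[sin c], the derivative in [r] of the difference is [2 (r sin c - c sin r)],
which by [sin_ratio_decreasing] has the sign of [r - c]. *)
Lemma sqr_gt_tangent {R : realType} (c r : R) :
  0 < c <= pi / 2 -> 0 <= r <= pi / 2 -> r != c ->
  c ^+ 2 + 2 * c / sin c * (cos c - cos r) < r ^+ 2.
Proof.
move=> /andP[c0 cpi] /andP[r0 rpi] rc.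
have pi0 := pi_gt0 R.
have sc : 0 < sin c by apply: sin_gt0_pi; lra.
pose h x := sin c * x ^+ 2 + 2 * c * cos x.
pose dh x := 2 * (x * sin c - c * sin x).
have dhE (x : R) : is_derive x 1 h (dh x).
  apply: is_derive_eq; rewrite /dh /GRing.scale/=; ring.
have ch a b : {within `[a, b], continuous h}.
  by apply: continuous_subspaceT => x; apply/differentiable_continuous/derivable1_diffP.
suff : h c < h r.
  rewrite /h => hcr; rewrite -subr_gt0.
  have -> : r ^+ 2 - (c ^+ 2 + 2 * c / sin c * (cos c - cos r)) =
    (sin c * r ^+ 2 + 2 * c * cos r - (sin c * c ^+ 2 + 2 * c * cos c)) / sin c.
    by field; rewrite gt_eqF.
  by rewrite divr_gt0// subr_gt0.
have [rltc|clt|/eqP] := ltgtP r c; last by rewrite (negbTE rc).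
  have [x xrc e] := MVT rltc (fun x _ => dhE x) (ch r c).
  move: xrc; rewrite in_itv/= => /andP[rx xc].
  rewrite -subr_lt0 e /dh pmulr_llt0 ?subr_gt0//.
  have : x * sin c < c * sin x by apply: sin_ratio_decreasing; lra.
  lra.
have [x xrc e] := MVT clt (fun x _ => dhE x) (ch c r).
move: xrc; rewrite in_itv/= => /andP[rx xc].
rewrite -subr_gt0 e /dh pmulr_lgt0 ?subr_gt0//.
have : c * sin x < x * sin c by apply: sin_ratio_decreasing; lra.
lra.
Qed.

(** * Integrals of continuous functions over segments *)

Lemma continuous_itv_integrable {R : realType} (f : R -> R) (a b : R) :
  continuous f -> (@lebesgue_measure R).-integrable `[a, b] (EFin \o f).
Proof.
move=> cf; apply: continuous_compact_integrable; first exact: segment_compact.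
exact: continuous_subspaceT.
Qed.

Lemma fine_lebesgue_measure_segment {R : realType} (a b : R) :
  a <= b -> fine (@lebesgue_measure R `[a, b]) = b - a.
Proof.
move=> ab; have := @lebesgue_measure_itv R `[a, b]; rewrite /= lte_fin => ->.
by case: ltgtP ab => //= ->; rewrite subrr.
Qed.

Lemma Rintegral_itv_split {R : realType} (f : R -> R) (a c b : R) :
  continuous f -> a <= c -> c <= b ->
  (\int[@lebesgue_measure R]_(x in `[a, b]) f x =
   \int[@lebesgue_measure R]_(x in `[a, c]) f x +
   \int[@lebesgue_measure R]_(x in `[c, b]) f x)%R.
Proof.
move=> cf ac cb.
have := @Rintegral_itvB R f (BLeft a) (BRight b) c
  (continuous_itv_integrable _ a b cf).
rewrite !bnd_simp => /(_ ac cb).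
rewrite (@Rintegral_itv_obnd_cbnd _ c (BRight b)); first by move=> <-; ring.
apply: integrableS (continuous_itv_integrable _ c b cf) => //.
exact: subset_itv_oc_cc.
Qed.

Lemma Rintegral_shift {R : realType} (f : R -> R) (s a b : R) :
  continuous f -> a <= b ->
  (\int[@lebesgue_measure R]_(x in `[a, b]) f (x + s) =
   \int[@lebesgue_measure R]_(x in `[a + s, b + s]) f x)%R.
Proof.
move=> cf ab.
have dF (x : R) : is_derive x 1 (fun x => x + s) (1 : R).
  by apply: is_derive_eq; rewrite addr0.
have F'E : derive1 (fun x : R => x + s) = cst 1.
  by apply/funext => x; rewrite derive1E derive_val.
have cF : continuous (fun x : R => x + s).
  by move=> x; apply: cvgD; [exact: cvg_id|exact: cvg_cst].
congr fine.
rewrite (@integration_by_substitution_increasing R (fun x => x + s) f a b)//.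
- apply: eq_integral => x _; by rewrite F'E /= /cst mulr1.
- by move=> x y _ _; rewrite ltrD2r.
- by rewrite F'E => x _; exact: cvg_cst.
- by rewrite F'E; exact: is_cvg_cst.
- by rewrite F'E; exact: is_cvg_cst.
- split.
  + by move=> x _; have := dF x => -[].
  + by apply: cvg_at_right_filter; exact: cF.
  + by apply: cvg_at_left_filter; exact: cF.
- exact: continuous_subspaceT.
Qed.

(** The part of the shifted integral that lies beyond [T] is carried back by
periodicity to the missing part over [[0, s]]. *)
Lemma Rintegral_periodic_shift {R : realType} (f : R -> R) (T s : R) :
  continuous f -> (forall x, f (x + T) = f x) -> 0 <= s -> s <= T ->
  (\int[@lebesgue_measure R]_(x in `[0, T]) f (x + s) =
   \int[@lebesgue_measure R]_(x in `[0%R, T]) f x)%R.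
Proof.
move=> cf fT s0 sT.
rewrite Rintegral_shift ?(le_trans s0)// add0r.
rewrite (@Rintegral_itv_split _ f s T)//; last by rewrite lerDl.
rewrite (@Rintegral_itv_split _ f 0 s T)// [LHS]addrC.
congr (_ + _); rewrite -[in LHS](add0r T) [_ + s]addrC add0r.
by rewrite -{1}(add0r T) -Rintegral_shift//; apply: eq_Rintegral => x _; rewrite fT.
Qed.

(** If [f x > 0], continuity gives a segment [[c, d]] around [x], cut down to
[[a, b]], on which [f] exceeds [f x / 2], and this contributes
[f x / 2 * (d - c)] to the integral. *)
Lemma Rintegral_eq0_continuous {R : realType} (f : R -> R) (a b x : R) :
  continuous f -> (forall y, 0 <= f y) ->
  (\int[@lebesgue_measure R]_(y in `[a, b]) f y = 0)%R ->
  a < b -> x \in `[a, b] -> f x = 0.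
Proof.
move=> cf f0 If ab; rewrite in_itv/= => /andP[ax xb].
apply/eqP; rewrite eq_le f0 andbT leNgt; apply/negP => fx.
have [e/= e0 He] : exists2 e : R, 0 < e & forall y, `|x - y| < e -> f x / 2 < f y.
  have : \forall y \near x, f x / 2 < f y.
    by apply: (cvgr_gt (f x) (cf x)); lra.
  by move=> /nbhs_ballP[e/= e0 He]; exists e => // y; apply: He.
pose c := Num.max a (x - e / 2); pose d := Num.min b (x + e / 2).
have cd : c < d by rewrite /c /d gt_max !lt_min; lra.
have ac : a <= c by rewrite /c le_max lexx.
have db : d <= b by rewrite /d ge_min lexx.
have cb : c <= b by exact: ltW (lt_le_trans cd db).
have lower : f x / 2 * (d - c) <= (\int[@lebesgue_measure R]_(y in `[c, d]) f y)%R.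
  rewrite -(fine_lebesgue_measure_segment _ _ (ltW cd)) -Rintegral_cst//.
  apply: le_Rintegral => //.
  - by apply: continuous_itv_integrable => y; exact: cvg_cst.
  - exact: continuous_itv_integrable.
  - move=> y /=; rewrite in_itv/= /c /d ge_max le_min => /andP[/andP[_ cy] /andP[_ yd]].
    by apply/ltW/He; rewrite ltr_distl; lra.
have ge0 u v : (0 <= \int[@lebesgue_measure R]_(y in `[u, v]) f y)%R.
  by apply: Rintegral_ge0.
have split3 : (\int[@lebesgue_measure R]_(y in `[a, b]) f y =
    \int[@lebesgue_measure R]_(y in `[a, c]) f y +
    (\int[@lebesgue_measure R]_(y in `[c, d]) f y +
     \int[@lebesgue_measure R]_(y in `[d, b]) f y))%R.
  rewrite (@Rintegral_itv_split _ f a c b)//.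
  by rewrite (@Rintegral_itv_split _ f c d b)//; exact: ltW.
have : 0 < f x / 2 * (d - c) by rewrite mulr_gt0 ?divr_gt0 ?subr_gt0.
move=> /lt_le_trans/(_ lower); rewrite -[X in _ < X]addr0 -[X in _ < X]add0r.
by move=> /lt_le_trans/(_ (lerD (ge0 a c) (lerD (lexx _) (ge0 d b)))); rewrite -split3 If ltxx.
Qed.

(** Jensen's inequality with its equality case.  The difference [J - (b - a) c ^+ 2]
is the integral of the gap [g] in the tangent line inequality at [c], since the
mean of [cos c - cos (f x)] is zero by the choice of [c].  Positivity of [f] makes
[c] positive, hence [sin c] nonzero. *)
Lemma mean_sqr_ge_acos_sqr {R : realType} (f : R -> R) (a b : R)
    (mu := @lebesgue_measure R)
    (I := (\int[mu]_(x in `[a, b]) (1 - cos (f x)))%R)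
    (J := (\int[mu]_(x in `[a, b]) (f x ^+ 2))%R)
    (c := acos (1 - I / (b - a))) :
  continuous f -> (forall x, 0 < f x <= pi / 2) -> a < b ->
  (b - a) * c ^+ 2 <= J /\
  (J = (b - a) * c ^+ 2 -> forall x, x \in `[a, b] -> f x = c).
Proof.
move=> cf fpi ab; have pi0 := pi_gt0 R.
have ba0 : 0 < b - a by rewrite subr_gt0.
have c1cf : continuous (fun x => 1 - cos (f x)).
  move=> x; apply: cvgB; first exact: cvg_cst.
  exact: (continuous_comp (cf x) (@continuous_cos R _)).
have cf2 : continuous (fun x => f x ^+ 2).
  by move=> x; exact: (cvgM (cf x) (cf x)).
have onem_ge0 x : 0 <= 1 - cos (f x) by rewrite subr_ge0 cos_le1.
have I0 : 0 < I.
  rewrite lt_def Rintegral_ge0 ?andbT//; apply/eqP => I0.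
  have aab : a \in `[a, b] by rewrite in_itv/= lexx ltW.
  have := Rintegral_eq0_continuous _ a b a c1cf onem_ge0 I0 ab aab.
  suff : cos (f a) < cos 0 by rewrite cos0; lra.
  by have fa := fpi a; rewrite ltr_cos ?in_itv/=; lra.
have Ile : I <= b - a.
  have -> : b - a = (\int[mu]_(x in `[a, b]) (cst 1) x)%R.
    by rewrite Rintegral_cst// mul1r fine_lebesgue_measure_segment ?ltW.
  apply: le_Rintegral => //.
  - exact: continuous_itv_integrable.
  - by apply: continuous_itv_integrable => y; exact: cvg_cst.
  - move=> x _ /=; rewrite gerBl; apply: cos_ge0_pihalf.
    by have := fpi x; lra.
have q01 : 0 < I / (b - a) <= 1 by rewrite divr_gt0//= ler_pdivrMr// mul1r.
have cc : cos c = 1 - I / (b - a) by rewrite acosK// in_itv/=; lra.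
have c0 : 0 < c by apply: acos_gt0; lra.
have cpi : c <= pi / 2.
  rewrite leNgt; apply/negP => cpi.
  have : c <= pi by apply: acos_lepi; lra.
  move=> clepi; have : cos c < cos (pi / 2) by rewrite ltr_cos ?in_itv/=; lra.
  by rewrite cos_pihalf cc; lra.
pose k := 2 * c / sin c.
pose g x := f x ^+ 2 - (c ^+ 2 + k * (cos c - 1) + k * (1 - cos (f x))).
have ckf : continuous (fun x => k * (1 - cos (f x))).
  by move=> x; apply: cvgM; [exact: cvg_cst|exact: c1cf].
have ckkf : continuous (fun x => c ^+ 2 + k * (cos c - 1) + k * (1 - cos (f x))).
  by move=> x; apply: cvgD; [exact: cvg_cst|exact: ckf].
have cg : continuous g by move=> x; apply: cvgB; [exact: cf2|exact: ckkf].
have g_gt0 x : f x != c -> 0 < g x.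
  move=> fxc; rewrite /g subr_gt0.
  have := @sqr_gt_tangent R c (f x); rewrite c0 cpi fxc => /(_ isT) H.
  have {}H := H ltac:(have := fpi x; lra) isT.
  by apply: le_lt_trans H; rewrite -/k; lra.
have g_ge0 x : 0 <= g x.
  have [fc|/g_gt0/ltW//] := eqVneq (f x) c.
  by rewrite /g fc le_eqVlt; apply/orP; left; apply/eqP; ring.
have gI : (\int[mu]_(x in `[a, b]) g x)%R = J - (b - a) * c ^+ 2.
  rewrite RintegralB//; [|exact: continuous_itv_integrable..].
  congr (_ - _); rewrite RintegralD//; last 2 first.
  - by apply: continuous_itv_integrable => y; exact: cvg_cst.
  - exact: continuous_itv_integrable.
  rewrite RintegralZl//; last exact: continuous_itv_integrable.
  rewrite Rintegral_cst// fine_lebesgue_measure_segment ?ltW//.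
  have alg (q l s t : R) : l != 0 -> (s + t * (1 - q / l - 1)) * l + t * q = l * s.
    by move=> l0; field.
  by rewrite cc; apply: alg; rewrite gt_eqF.
split; first by rewrite -subr_ge0 -gI; apply: Rintegral_ge0.
move=> Jc x xab; apply/eqP/negPn/negP => /g_gt0.
rewrite (Rintegral_eq0_continuous _ a b x cg g_ge0 _ ab xab) ?ltxx//.
by rewrite gI Jc subrr.
Qed.

(** * The hemisphere in coordinates *)

Lemma dotE {R : realType} (x y : 'rV[R]_3) :
  dot x y = x ord0 0 * y ord0 0 + x ord0 1 * y ord0 1 + x ord0 2 * y ord0 2.
Proof.
rewrite /dot !big_ord_recl big_ord0 addr0 addrA.
have -> : lift ord0 ord0 = 1 :> 'I_3 by exact: val_inj.
by have -> : lift ord0 (lift ord0 ord0) = 2 :> 'I_3 by exact: val_inj.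
Qed.

Lemma row3P {R : realType} (x y : 'rV[R]_3) :
  x ord0 0 = y ord0 0 -> x ord0 1 = y ord0 1 -> x ord0 2 = y ord0 2 -> x = y.
Proof.
move=> e0 e1 e2; apply/rowP => -[[|[|[|//]]] h].
- by rewrite (_ : Ordinal h = 0)//; exact: val_inj.
- by rewrite (_ : Ordinal h = 1)//; exact: val_inj.
- by rewrite (_ : Ordinal h = 2)//; exact: val_inj.
Qed.

Lemma pole_coords {R : realType} :
  ((@pole R) ord0 0 = 0) * ((@pole R) ord0 1 = 0) * ((@pole R) ord0 2 = 1).
Proof. by rewrite !mxE. Qed.

Lemma circle_pt_coords {R : realType} (th : R) :
  (circle_pt th ord0 0 = cos th) * (circle_pt th ord0 1 = sin th) *
  (circle_pt th ord0 2 = 0).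
Proof. by rewrite !mxE. Qed.

Lemma quarter_turn_coords {R : realType} (u : 'rV[R]_3) :
  (quarter_turn u ord0 0 = - u ord0 1) * (quarter_turn u ord0 1 = u ord0 0) *
  (quarter_turn u ord0 2 = 0).
Proof. by rewrite !mxE. Qed.

Lemma geodesic_coords {R : realType} (u : 'rV[R]_3) (t : R) :
  u ord0 2 = 0 ->
  (geodesic u t ord0 0 = sin t * u ord0 0) *
  (geodesic u t ord0 1 = sin t * u ord0 1) *
  (geodesic u t ord0 2 = cos t).
Proof. by move=> u2; rewrite !mxE /= u2 !mulr0 !add0r mulr1 addr0. Qed.

Lemma tangent_circleP {R : realType} (u : 'rV[R]_3) :
  tangent_circle u <-> u ord0 0 ^+ 2 + u ord0 1 ^+ 2 = 1 /\ u ord0 2 = 0.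
Proof.
rewrite /tangent_circle /= !dotE !pole_coords !mulr0 !add0r mulr1.
by split=> -[h1 h2]; split=> //; move: h1; rewrite h2 mulr0 addr0 !expr2.
Qed.

Lemma hemisphereP {R : realType} (x : 'rV[R]_3) :
  hemisphere x <->
  x ord0 0 ^+ 2 + x ord0 1 ^+ 2 + x ord0 2 ^+ 2 = 1 /\ 0 <= x ord0 2.
Proof.
by rewrite /hemisphere /= !dotE !pole_coords !mulr0 !add0r mulr1 !expr2.
Qed.

Lemma tangent_circle_pt {R : realType} (th : R) : tangent_circle (circle_pt th).
Proof. by apply/tangent_circleP; rewrite !circle_pt_coords cos2Dsin2. Qed.

Lemma unit_circle_angle {R : realType} (a b : R) : a ^+ 2 + b ^+ 2 = 1 ->
  exists2 th, th \in `[0, 2 * pi] & a = cos th /\ b = sin th.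
Proof.
move=> ab; have pi0 := pi_gt0 R.
have b2 : 0 <= b ^+ 2 by exact: sqr_ge0.
have a1 : -1 <= a <= 1.
  rewrite -ler_norml -(@ler_pXn2r _ 2)// ?nnegrE// expr1n.
  by rewrite real_normK ?num_real//; lra.
have ac : cos (acos a) = a by rewrite acosK// in_itv.
have sac : sin (acos a) = `|b|.
  by rewrite sin_acos// -ab addrC addKr sqrtr_sqr.
have c0 := acos_ge0 a1; have cpi := acos_lepi a1.
have [b0|b0] := leP 0 b.
  exists (acos a); first by rewrite in_itv/=; lra.
  by rewrite ac sac ger0_norm.
exists (2 * pi - acos a); first by rewrite in_itv/=; lra.
rewrite addrC mulr_natl cosD2pi sinD2pi cosN sinN ac sac ltr0_norm// opprK.
by [].
Qed.

Lemma tangent_circle_angle {R : realType} (u : 'rV[R]_3) : tangent_circle u ->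
  exists2 th, th \in `[0, 2 * pi] & u = circle_pt th.
Proof.
move=> /tangent_circleP[/unit_circle_angle[th th02 [u0 u1]] u2]; exists th => //.
by apply: row3P; rewrite circle_pt_coords.
Qed.

Lemma tangent_circleN {R : realType} (u : 'rV[R]_3) :
  tangent_circle u -> tangent_circle (- u).
Proof.
move=> /tangent_circleP[u01 u2]; apply/tangent_circleP.
by rewrite !mxE u2 oppr0 !sqrrN.
Qed.

Lemma tangent_quarter_turn {R : realType} (u : 'rV[R]_3) :
  tangent_circle u -> tangent_circle (quarter_turn u).
Proof.
move=> /tangent_circleP[u01 u2]; apply/tangent_circleP.
by rewrite !quarter_turn_coords sqrrN addrC.
Qed.

Lemma quarter_turn_circle_pt {R : realType} (th : R) :
  quarter_turn (circle_pt th) = circle_pt (th + pi / 2).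
Proof.
by apply: row3P; rewrite quarter_turn_coords !circle_pt_coords
  ?cosDpihalf ?sinDpihalf.
Qed.

Lemma circle_ptD2pi {R : realType} (th : R) :
  circle_pt (th + 2 * pi) = circle_pt th.
Proof.
by apply: row3P; rewrite !circle_pt_coords// mulr_natl ?cosD2pi ?sinD2pi.
Qed.

Lemma hemisphere_geodesic {R : realType} (u : 'rV[R]_3) (t : R) :
  tangent_circle u -> - (pi / 2) <= t <= pi / 2 -> hemisphere (geodesic u t).
Proof.
move=> /tangent_circleP[u01 u2] tpi; apply/hemisphereP.
rewrite !geodesic_coords//; split; last exact: cos_ge0_pihalf.
by rewrite !exprMn -mulrDr u01 mulr1 addrC cos2Dsin2.
Qed.

Lemma perp_geodesic {R : realType} (xi : 'rV[R]_3) (t : R) :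
  tangent_circle xi -> - (pi / 2) <= t <= pi / 2 ->
  perp xi (geodesic (quarter_turn xi) t).
Proof.
move=> txi tpi; split.
  by apply: hemisphere_geodesic => //; exact: tangent_quarter_turn.
move: txi => /tangent_circleP[_ xi2].
rewrite dotE !geodesic_coords ?quarter_turn_coords// xi2; ring.
Qed.

Lemma geodist_geodesic {R : realType} (u : 'rV[R]_3) (t : R) :
  tangent_circle u -> 0 <= t <= pi -> geodist (geodesic u t) pole = t.
Proof.
move=> /tangent_circleP[_ u2] tpi.
rewrite /geodist dotE !geodesic_coords// !pole_coords !mulr0 !add0r mulr1.
by rewrite cosK// in_itv.
Qed.

Lemma geodesicN {R : realType} (u : 'rV[R]_3) (t : R) :
  geodesic (- u) t = geodesic u (- t).
Proof. by rewrite /geodesic cosN sinN scalerN scaleNr. Qed.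

Lemma geodesic0 {R : realType} (u : 'rV[R]_3) : geodesic u 0 = pole.
Proof. by rewrite /geodesic cos0 sin0 scale1r scale0r addr0. Qed.

Lemma hemisphere_polar {R : realType} (x : 'rV[R]_3) : hemisphere x ->
  exists u t, [/\ tangent_circle u, 0 <= t <= pi / 2 & x = geodesic u t].
Proof.
move=> /hemisphereP[x1 x20]; have pi0 := pi_gt0 R.
have h0 : 0 <= x ord0 0 ^+ 2 by exact: sqr_ge0.
have h1 : 0 <= x ord0 1 ^+ 2 by exact: sqr_ge0.
have x2le1 : x ord0 2 <= 1 by rewrite -(@ler_pXn2r _ 2)// ?nnegrE// expr1n; lra.
have x2b : -1 <= x ord0 2 <= 1 by lra.
pose t := acos (x ord0 2).
have ct : cos t = x ord0 2 by rewrite acosK// in_itv.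
have t0 : 0 <= t by exact: acos_ge0.
have tpi : t <= pi / 2.
  rewrite leNgt; apply/negP => tpi.
  have tlepi : t <= pi by exact: acos_lepi.
  have : cos t < cos (pi / 2) by rewrite ltr_cos ?in_itv/=; lra.
  by rewrite cos_pihalf ct; lra.
have st : sin t ^+ 2 = x ord0 0 ^+ 2 + x ord0 1 ^+ 2 by rewrite sin2cos2 ct; lra.
have [st0|st0] := eqVneq (sin t) 0.
  (* At the pole every direction is suitable. *)
  exists (circle_pt 0), t; split; [exact: tangent_circle_pt|by rewrite t0|].
  have := st; rewrite st0 expr0n/= => /esym/eqP.
  rewrite paddr_eq0// !sqrf_eq0 => /andP[/eqP x0 /eqP x1'].
  by apply: row3P; rewrite geodesic_coords ?circle_pt_coords// st0 mul0r.
(* Away from the pole, normalizing the horizontal part gives the direction. *)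
pose u : 'rV[R]_3 := \row_(i < 3) [:: x ord0 0 / sin t; x ord0 1 / sin t; 0]`_i.
have u0 : u ord0 0 = x ord0 0 / sin t by rewrite mxE.
have u1 : u ord0 1 = x ord0 1 / sin t by rewrite mxE.
have u2 : u ord0 2 = 0 by rewrite mxE.
exists u, t; split; [|by rewrite t0|].
  apply/tangent_circleP; split => //; rewrite u0 u1 !expr_div_n -mulrDl -st.
  by rewrite divff// sqrf_eq0.
by apply: row3P; rewrite geodesic_coords// ?u0 ?u1 1?mulrC ?divfK// ct.
Qed.

Lemma continuous_dotl {R : realType} (u : 'rV[R]_3) : continuous (fun x => dot x u).
Proof.
have cc i : continuous (fun x : 'rV[R]_3 => x ord0 i * u ord0 i).
  move=> x.
  exact: (cvgM (@coord_continuous _ _ _ ord0 i x) (cvg_cst (u ord0 i))).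
rewrite (_ : (fun x => dot x u) = fun x => x ord0 0 * u ord0 0 + x ord0 1 * u ord0 1 +
    x ord0 2 * u ord0 2); last by apply/funext => x; exact: dotE.
by move=> x; exact: (cvgD (cvgD (cc 0 x) (cc 1 x)) (cc 2 x)).
Qed.

Lemma continuous_trig_comb {R : realType} (p q : 'rV[R]_3) :
  continuous (fun t : R => cos t *: p + sin t *: q).
Proof.
move=> t; exact: (cvgD (cvgZ (@continuous_cos R t) (cvg_cst p))
  (cvgZ (@continuous_sin R t) (cvg_cst q))).
Qed.

Lemma continuous_circle_pt {R : realType} : continuous (@circle_pt R).
Proof.
rewrite (_ : @circle_pt R =
  fun t => cos t *: circle_pt 0 + sin t *: circle_pt (pi / 2)).
  exact: continuous_trig_comb.
apply/funext => t; apply: row3P; rewrite !mxE/=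
  ?cos0 ?sin0 ?cos_pihalf ?sin_pihalf; ring.
Qed.

(** * Star bodies in polar coordinates *)

Lemma Rintegral_sin {R : realType} (r : R) : 0 < r ->
  (\int[@lebesgue_measure R]_(t in `[0, r]) sin t)%R = 1 - cos r.
Proof.
move=> r0; rewrite /Rintegral.
rewrite (@continuous_FTC2 R sin (fun t => - cos t) 0 r)//.
- by rewrite cos0 /=; ring.
- by apply: continuous_subspaceT; exact: continuous_sin.
- have cc : continuous (fun t : R => - cos t).
    by move=> t; exact: (cvgN (@continuous_cos R t)).
  split; first by move=> t _; exact: derivableN.
  + by apply: cvg_at_right_filter; exact: cc.
  + by apply: cvg_at_left_filter; exact: cc.
- move=> t _; rewrite derive1E deriveN; last exact: derivable_cos.
  by rewrite derive_val opprK.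
Qed.

Lemma radialE {R : realType} (K : set 'rV[R]_3) (u : 'rV[R]_3) :
  tangent_circle u ->
  radial K u = sup [set t | 0 <= t <= pi / 2 /\ K (geodesic u t)].
Proof.
move=> tu; have pi0 := pi_gt0 R.
have gd (t : R) : 0 <= t <= pi / 2 -> geodist (geodesic u t) pole = t.
  by move=> tpi; apply: geodist_geodesic => //; lra.
congr sup; apply/seteqP; split=> [_ [x [Kx [t /= tpi xE]] <-]|t [tpi Kt]] /=.
  by move: tpi Kx; rewrite in_itv/= -xE => tpi Kt; rewrite gd.
exists (geodesic u t); last exact: gd.
by split => //; exists t => //=; rewrite in_itv.
Qed.

Lemma radial_bounds {R : realType} (K : set 'rV[R]_3) (u : 'rV[R]_3) :
  star_body K -> tangent_circle u -> 0 < radial K u <= pi / 2.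
Proof.
move=> [_ _ starK posK _] tu; rewrite posK//= radialE//.
have pi0 := pi_gt0 R.
apply: ge_sup; last by move=> t [/andP[]].
exists 0; split; first lra.
by rewrite geodesic0; have [[]] := starK _ tu.
Qed.

(** The supremum that defines the radial function is attained because the set of
admissible parameters is the preimage of the closed set [K], cut to a segment. *)
Lemma geodesic_radial {R : realType} (K : set 'rV[R]_3) (u : 'rV[R]_3) :
  star_body K -> tangent_circle u -> K (geodesic u (radial K u)).
Proof.
move=> [_ cK starK _ _] tu; have pi0 := pi_gt0 R.
set E := [set t | 0 <= t <= pi / 2 /\ K (geodesic u t)].
suff: E (sup E) by rewrite radialE// => -[].
have closedE : closed E.
  rewrite (_ : E = `[0, pi / 2] `&` geodesic u @^-1` K); last first.
    by apply/seteqP; split=> t; rewrite /E /= in_itv.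
  apply: closedI; first exact: itv_closed.
  apply: (continuous_closedP _).1; first exact: continuous_trig_comb.
  apply: compact_closed => //; exact: norm_hausdorff.
apply: closedE; apply: closure_sup.
  exists 0; split; first lra.
  by rewrite geodesic0; have [[]] := starK _ tu.
by exists (pi / 2) => t [/andP[]].
Qed.

(** The slice of [K] by the geodesic line that carries the ray [u] is connected and
contains both the pole and the point at distance [radial K u].  Its image under the
height function [dot ^~ u] is therefore an interval containing [0] and
[sin (radial K u)], so it contains [sin t]; and a point of the closed half-circle
is determined by its height. *)
Lemma geodesic_star_body {R : realType} (K : set 'rV[R]_3) (u : 'rV[R]_3) (t : R) :
  star_body K -> tangent_circle u -> 0 <= t <= pi / 2 ->
  K (geodesic u t) <-> t <= radial K u.
Proof.
move=> sK tu tpi; have pi0 := pi_gt0 R; split => [Kt|tr].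
  by rewrite radialE//; apply: ub_le_sup => //; exists (pi / 2) => s [/andP[]].
have /andP[r0 rpi] := radial_bounds _ _ sK tu.
have Kr := geodesic_radial _ _ sK tu.
move: (sK) => [KH _ starK _ _].
have [u01 u2] := (tangent_circleP _).1 tu.
pose S := K `&` perp (quarter_turn u).
have [[Kpole pperp] connS] := starK _ (tangent_quarter_turn _ tu).
have dotu s : dot (geodesic u s) u = sin s.
  rewrite dotE !geodesic_coords// u2 mulr0 addr0 -!mulrA -!expr2 -mulrDr u01.
  by rewrite mulr1.
have /connected_intervalP itvS : connected ((fun x => dot x u) @` S).
  apply: connected_continuous_connected => //.
  by apply: continuous_subspaceT; exact: continuous_dotl.
have S0 : ((fun x => dot x u) @` S) 0.
  by exists pole => //; rewrite -(geodesic0 u) dotu sin0.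
have Sr : ((fun x => dot x u) @` S) (sin (radial K u)).
  exists (geodesic u (radial K u)); last exact: dotu.
  split => //; split; first by apply: hemisphere_geodesic => //; lra.
  by rewrite dotE !geodesic_coords// !quarter_turn_coords; ring.
have sint : 0 <= sin t <= sin (radial K u).
  rewrite sin_ge0_pi/=; last lra.
  rewrite leNgt; apply/negP; rewrite ltr_sin ?in_itv/=; lra.
have [x [Kx [Hx xperp]] xsin] := itvS _ _ S0 Sr _ sint.
suff <- : x = geodesic u t by [].
have [x1 x20] := (hemisphereP _).1 Hx.
move: xsin xperp; rewrite !dotE !quarter_turn_coords u2 !mulr0 !addr0 => e1 e2.
(* [e1] and [e2] give the coordinates of [x] in the orthonormal frame of [u] and
   [quarter_turn u]; rotating back gives the horizontal coordinates of [x]. *)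
have x0 : x ord0 0 = sin t * u ord0 0.
  transitivity (x ord0 0 * (u ord0 0 ^+ 2 + u ord0 1 ^+ 2)).
    by rewrite u01 mulr1.
  rewrite -e1.
  transitivity ((x ord0 0 * u ord0 0 + x ord0 1 * u ord0 1) * u ord0 0
    - (x ord0 0 * - u ord0 1 + x ord0 1 * u ord0 0) * u ord0 1); first ring.
  by rewrite e2 mul0r subr0.
have x1' : x ord0 1 = sin t * u ord0 1.
  transitivity (x ord0 1 * (u ord0 0 ^+ 2 + u ord0 1 ^+ 2)).
    by rewrite u01 mulr1.
  rewrite -e1.
  transitivity ((x ord0 0 * u ord0 0 + x ord0 1 * u ord0 1) * u ord0 1
    + (x ord0 0 * - u ord0 1 + x ord0 1 * u ord0 0) * u ord0 0); first ring.
  by rewrite e2 mul0r addr0.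
apply: row3P; rewrite geodesic_coords//.
have cost : 0 <= cos t by apply: cos_ge0_pihalf; lra.
apply/eqP; rewrite -(@eqrXn2 _ 2)//; apply/eqP.
by move: x1; rewrite cos2sin2 x0 x1' !exprMn -mulrDr u01 mulr1 => <-; ring.
Qed.

Lemma area_star_body {R : realType} (K : set 'rV[R]_3) : star_body K ->
  area K = (\int[@lebesgue_measure R]_(th in `[0, 2 * pi])
    (1 - cos (radial K (circle_pt th))))%R.
Proof.
move=> sK; apply: eq_Rintegral => th _.
have tu := tangent_circle_pt th; set u := circle_pt th in tu *.
have /andP[r0 rpi] := radial_bounds _ _ sK tu.
rewrite -Rintegral_sin//.
rewrite (_ : `[0, radial K u]%classic = `[0, pi / 2] `&` `[0, radial K u]); last first.
  by rewrite setIidr// => t /=; rewrite !in_itv/=; lra.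
rewrite Rintegral_mkcondr; apply: eq_Rintegral => t.
rewrite inE/= in_itv/= => tpi; rewrite patchE indicE.
have Kt := geodesic_star_body K u t sK tu tpi.
have [tr|tr] := leP t (radial K u).
  rewrite mem_set; last exact/Kt.
  by rewrite mem_set ?mul1r//= in_itv/= tr; case/andP: tpi => ->.
rewrite memNset ?mul0r; last by move/Kt; lra.
by rewrite memNset//= in_itv/=; lra.
Qed.

(** The parameters [t < 0] on the line run along the opposite ray, so the section is
parametrized by the segment from [- radial K (- u)] to [radial K u]. *)
Lemma length_perp_star_body {R : realType} (K : set 'rV[R]_3) (xi : 'rV[R]_3) :
  star_body K -> tangent_circle xi ->
  length_perp xi (K `&` perp xi) =
  radial K (quarter_turn xi) + radial K (- quarter_turn xi).
Proof.
move=> sK txi; have tu := tangent_quarter_turn _ txi.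
have tNu := tangent_circleN _ tu.
have /andP[r0 rpi] := radial_bounds _ _ sK tu.
have /andP[s0 spi] := radial_bounds _ _ sK tNu.
set u := quarter_turn xi in tu tNu r0 rpi s0 spi *.
rewrite /length_perp -/u.
rewrite (_ : _ `&` _ = `[- radial K (- u), radial K u]%classic).
  by rewrite fine_lebesgue_measure_segment ?opprK//; lra.
apply/seteqP; split => t /=; rewrite !in_itv/=.
  move=> [tpi [Kt _]]; have [t0|t0] := leP 0 t.
    have := (geodesic_star_body K u t sK tu ltac:(lra)).1 Kt; lra.
  move: Kt; rewrite -[t]opprK -geodesicN => Kt.
  have := (geodesic_star_body K (- u) (- t) sK tNu ltac:(lra)).1 Kt; lra.
move=> tr; have tpi : - (pi / 2) <= t <= pi / 2 by lra.
split => //; split; last exact: perp_geodesic.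
have [t0|t0] := leP 0 t.
  by apply/(geodesic_star_body K u t sK tu); lra.
rewrite -[t]opprK -geodesicN.
by apply/(geodesic_star_body K (- u) (- t) sK tNu); lra.
Qed.

Lemma continuous_radial_circle_pt {R : realType} (K : set 'rV[R]_3) :
  star_body K -> continuous (fun th => radial K (circle_pt th)).
Proof.
move=> [_ _ _ _ /subspace_continuousP cr] th.
have := cr _ (tangent_circle_pt th); apply: cvg_trans => /= P.
rewrite /= !nbhs_simpl/= => wP.
have cP := continuous_circle_pt th _ wP.
apply: (@filterS _ (nbhs th) _ _ _ _ cP) => s /= HP.
exact: (HP (tangent_circle_pt s)).
Qed.

(** A ball of radius [r > pi / 2] is the whole hemisphere, so that the constant value
of the radial function is the minimum of [r] and [pi / 2]. *)
Lemma centered_ballP {R : realType} (K : set 'rV[R]_3) : star_body K ->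
  (exists2 r : R, 0 < r & K = centered_ball r) <->
  exists c, forall u, tangent_circle u -> radial K u = c.
Proof.
move=> sK; have pi0 := pi_gt0 R; split.
  move=> [r r0 Kr]; exists (Num.min r (pi / 2)) => u tu.
  have Kt t : 0 <= t <= pi / 2 -> (t <= radial K u) = (t <= r).
    move=> tpi; apply/idP/idP => [|tr].
      move/(geodesic_star_body K u t sK tu tpi); rewrite Kr => -[_].
      by rewrite geodist_geodesic//; lra.
    apply/(geodesic_star_body K u t sK tu tpi); rewrite Kr; split.
      by apply: hemisphere_geodesic => //; lra.
    by rewrite geodist_geodesic//; lra.
  have /andP[rho0 rhopi] := radial_bounds _ _ sK tu.
  apply/eqP; rewrite eq_le; apply/andP; split.
    rewrite le_min rhopi andbT -Kt//; lra.
  rewrite Kt; first by rewrite ge_min lexx.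
  by rewrite le_min ge_min lexx orbT andbT !ltW//=; lra.
move=> [c Kc]; exists c.
  have := radial_bounds _ _ sK (tangent_circle_pt 0).
  by rewrite Kc; [case/andP|exact: tangent_circle_pt].
have Kt (u : 'rV[R]_3) t : tangent_circle u -> 0 <= t <= pi / 2 ->
    K (geodesic u t) <-> geodist (geodesic u t) pole <= c.
  move=> tu tpi; rewrite geodist_geodesic//; last lra.
  by rewrite -(Kc u tu); exact: geodesic_star_body.
have [KH _ _ _ _] := sK.
apply/seteqP; split=> [x Kx|x [/hemisphere_polar[u [t [tu tpi ->]]] xc]].
  have Hx := KH _ Kx; split => //.
  by have [u [t [tu tpi xE]]] := hemisphere_polar _ Hx; move: Kx; rewrite xE => /Kt; apply.
exact/Kt.
Qed.

Theorem theorem5p1 (R : realType) (K : set 'rV[R]_3)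
  (starK : star_body K) (symK : origin_symmetric K) :
  let lhs := circle_integral (fun xi => length_perp xi (K `&` perp xi) ^+ 2) in
  let rhs := 8 * pi * acos (1 - area K / (2 * pi)) ^+ 2 in
  lhs >= rhs /\
  (lhs = rhs <-> exists2 r : R, 0 < r & K = centered_ball r).
Proof.
move=> lhs rhs; have pi0 := pi_gt0 R.
pose rho (th : R) := radial K (circle_pt th).
have crho : continuous rho := continuous_radial_circle_pt K starK.
have rho_bounds th : 0 < rho th <= pi / 2.
  exact: radial_bounds starK (tangent_circle_pt th).
pose J := (\int[@lebesgue_measure R]_(th in `[0, 2 * pi]) (rho th ^+ 2))%R.
have crho2 : continuous (fun th => rho th ^+ 2).
  by move=> th; exact: (cvgM (crho th) (crho th)).
have lhsE : lhs = 4 * J.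
  rewrite /J -(@Rintegral_periodic_shift _ _ (2 * pi) (pi / 2))//; last 3 first.
  - by move=> th; rewrite /rho circle_ptD2pi.
  - lra.
  - lra.
  rewrite -RintegralZl//; last first.
    apply: continuous_itv_integrable => th.
    have cs : (fun x : R => x + pi / 2) @ th --> th + pi / 2.
      by apply: cvgD; [exact: cvg_id|exact: cvg_cst].
    exact: (cvg_comp _ _ cs (crho2 _)).
  apply: eq_Rintegral => th _; have txi := tangent_circle_pt th.
  rewrite length_perp_star_body// -symK; last exact: tangent_quarter_turn.
  by rewrite quarter_turn_circle_pt -/(rho _); ring.
have := mean_sqr_ge_acos_sqr rho 0 (2 * pi) crho rho_bounds ltac:(lra).
rewrite subr0 -area_star_body// -/J; set c := acos _ => -[Jge Jeq].
have rhsE : rhs = 4 * (2 * pi * c ^+ 2) by rewrite /rhs -/c; ring.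
split; first by rewrite lhsE rhsE ler_pM2l.
rewrite centered_ballP//; split.
  rewrite lhsE rhsE => e; exists c => u /tangent_circle_angle[th thI ->].
  by apply: Jeq => //; apply: (mulfI _ e); rewrite pnatr_eq0.
move=> [r Kr]; have rhoE th : rho th = r := Kr _ (tangent_circle_pt th).
have cE : c = r.
  rewrite /c area_star_body// (@eq_Rintegral _ _ _ _ _ (cst (1 - cos r))); last first.
    by move=> th _ /=; rewrite -/(rho th) rhoE.
  rewrite Rintegral_cst// fine_lebesgue_measure_segment; last lra.
  rewrite subr0 mulfK; last by rewrite gt_eqF//; lra.
  rewrite subKr cosK// in_itv/=.
  by have := rho_bounds 0; rewrite rhoE; lra.
rewrite lhsE rhsE cE /J (@eq_Rintegral _ _ _ _ _ (cst (r ^+ 2))); last first.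
  by move=> th _ /=; rewrite rhoE.
rewrite Rintegral_cst// fine_lebesgue_measure_segment; last lra.
by rewrite subr0 [2 * pi * _]mulrC.
Qed.
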